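(* Let $d\in\mathbb{N}$, $n\ge2$, let $\mathfrak{W}^{(1)},\dots,\mathfrak{W}^{(n)}$ be an i.i.d. sample from $\mathcal{W}_d(\alpha,\Sigma)$ with $\alpha\in(d-1,\infty)$ and $\Sigma\in\mathcal{S}_{++}^d$ both unknown, and let $\widehat M=\frac1n\sum_{k=1}^n\mathfrak{W}^{(k)}$. The Stein's method-of-moments estimators based on the linear probes $f_U(S)=\mathrm{tr}(US)$, $U\in\mathcal{S}^d$, together with the probes $q(S)=\mathrm{tr}(S^2)$ and $\ell(S)=\mathrm{tr}(S\log(S)-S)$, respectively, are given by $$\widehat\alpha_{\mathrm{quad}}=\frac{\{\mathrm{tr}(\widehat M)\}^2+\mathrm{tr}(\widehat M^2)}{\overline{\mathrm{tr}(\mathfrak{W}^2)}-\mathrm{tr}(\widehat M^2)},\qquad\widehat\Sigma_{\mathrm{quad}}=\frac{\widehat M}{\widehat\alpha_{\mathrm{quad}}},$$ $$\widehat\alpha_{\mathrm{log}}=\frac{2\,\overline{\mathcal{J}_{\mathfrak{W}}(\widehat M)}}{\overline{\mathrm{tr}\{\mathfrak{W}\log(\mathfrak{W})\}}-\mathrm{tr}\{\widehat M\,\overline{\log(\mathfrak{W})}\}},\qquad\widehat\Sigma_{\mathrm{log}}=\frac{\widehat M}{\widehat\alpha_{\mathrm{log}}},$$ provided that the denominators of $\widehat\alpha_{\mathrm{quad}}$ and $\widehat\alpha_{\mathrm{log}}$ are nonzero.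
   Context: $\mathcal{S}^d,\mathcal{S}_{++}^d$: real symmetric, positive definite $d\times d$ matrices; $\mathcal{W}_d(\alpha,\Sigma)$ is the Wishart law (carried by $\mathcal{S}_{++}^d$). For a function $g$ on $\mathcal{S}_{++}^d$, $\overline{g(\mathfrak{W})}=\frac1n\sum_{k=1}^ng(\mathfrak{W}^{(k)})$ (with a fixed second argument such as $\widehat M$ held constant). $\log(S)$ is the symmetric matrix logarithm. $\nabla=(\tfrac12(1+\delta_{ij})\,\partial/\partial S_{ij})_{i,j}$ is the symmetric gradient. In terms of $M=\alpha\Sigma$, the Wishart Stein operator is $\mathcal{A}^{\mathcal{W}}_{M,\alpha}f(S)=2\,\mathrm{tr}\{(M-S)\nabla f(S)\}+\frac4\alpha\,\mathrm{tr}\{S\nabla M\nabla f(S)\}$, with $\mathrm{tr}\{S\nabla M\nabla f(S)\}=\sum_{i,j,k,\ell}S_{ij}M_{k\ell}\nabla_{jk}\nabla_{\ell i}f(S)$. The Stein's method-of-moments estimator based on a collection of test functions is the pair $(\widehat M,\widehat\alpha)$, with $\widehat M\in\mathcal{S}^d$, solving the empirical Stein equations $\overline{\mathcal{A}^{\mathcal{W}}_{\widehat M,\widehat\alpha}f(\mathfrak{W})}=0$ for all $f$ in the collection (here: all $f_U$, $U\in\mathcal{S}^d$, together with $q$ for ''quad'', respectively with $\ell$ for ''log''), and the estimator of $\Sigma$ is $\widehat M/\widehat\alpha$. For $x,y>0$, $\log^{[1]}(x,y)=(\log x-\log y)/(x-y)$ if $x\ne y$ and $1/x$ if $x=y$.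 If $S=H\Lambda H^\top$ with $H$ orthogonal and $\Lambda=\mathrm{diag}(\lambda_1,\dots,\lambda_d)$, let $M^{(S)}=H^\top MH$ and $$\mathcal{J}_S(M)=\frac12\mathrm{tr}(M)+\frac12\sum_{i,j=1}^d\lambda_i\,M^{(S)}_{jj}\,\log^{[1]}(\lambda_j,\lambda_i).$$ *)

(* Defs.v *)
From HB Require Import structures.
From mathcomp Require Import all_boot all_order all_algebra.
From mathcomp Require Import all_classical all_reals all_analysis.

Set Implicit Arguments.
Unset Strict Implicit.
Unset Printing Implicit Defensive.

Import Order.TTheory GRing.Theory Num.Theory.
Import numFieldNormedType.Exports.

Local Open Scope classical_set_scope.
Local Open Scope ring_scope.

Section Matrices.
Context {R : realType} {d : nat}.
Implicit Types (S M H : 'M[R]_d) (lam : 'rV[R]_d).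

Definition symmetric_mx S : Prop := S^T = S.

Definition posdef S : Prop :=
  symmetric_mx S /\
  forall x : 'rV[R]_d, x != 0 -> 0 < (x *m S *m x^T) 0 0.

(* The matrix along which the (i, j) coordinate of a symmetric matrix moves:
   S_ij and S_ji are the same coordinate, so S = \sum_(i <= j) S_ij E_ij with
   E_ij := sym_dir i j, and the partial derivative in S_ij is 'D_(E_ij). *)
Definition sym_dir (i j : 'I_d) : 'M[R]_d :=
  if i == j then delta_mx i i else delta_mx i j + delta_mx j i.

Definition is_eigdec S (p : 'M[R]_d * 'rV[R]_d) : Prop :=
  p.1 *m p.1^T = 1%:M /\ S = p.1 *m diag_mx p.2 *m p.1^T.

(* Some decomposition S = H diag(lam) H^T with H orthogonal; junk if S is not
   symmetric. Lemmas logmxE and calJE below show that the choice is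
   immaterial. *)
Definition eigdec S : 'M[R]_d * 'rV[R]_d :=
  xget (1%:M, 0) [set p | is_eigdec S p].

Definition logmx S : 'M[R]_d :=
  let: (H, lam) := eigdec S in H *m diag_mx (map_mx (@ln R) lam) *m H^T.

Definition log_dd (x y : R) : R :=
  if x == y then x^-1 else (ln x - ln y) / (x - y).

Definition calJ_of H lam M : R :=
  let MS := H^T *m M *m H in
  2^-1 * \tr M +
  2^-1 * \sum_i \sum_j lam 0 i * MS j j * log_dd (lam 0 j) (lam 0 i).

Definition calJ S M : R := let: (H, lam) := eigdec S in calJ_of H lam M.

Lemma eigdec_fun_uniq S p q (g : R -> R) : is_eigdec S p -> is_eigdec S q ->
  p.1 *m diag_mx (map_mx g p.2) *m p.1^T =
  q.1 *m diag_mx (map_mx g q.2) *m q.1^T.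
Proof.
case: p q => [H l] [K m] /= [/[dup] HH /mulmx1C HH' SH] [/[dup] KK /mulmx1C KK' SK].
have E : diag_mx l *m (H^T *m K) = (H^T *m K) *m diag_mx m.
  have : H^T *m S *m K = H^T *m S *m K by [].
  by rewrite {1}SH {1}SK !mulmxA HH' mul1mx -!mulmxA KK' mulmx1 !mulmxA.
have Eg : diag_mx (map_mx g l) *m (H^T *m K) =
          (H^T *m K) *m diag_mx (map_mx g m).
  apply/matrixP => i j; move/matrixP: E => /(_ i j).
  rewrite !mul_diag_mx !mul_mx_diag !mxE.
  set c := (\sum_(_ | _) _); rewrite mulrC => /eqP.
  rewrite -subr_eq0 -mulrBr mulf_eq0 subr_eq0 => /orP[]/eqP->.
    by rewrite mul0r mulr0.
  by rewrite mulrC.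
rewrite -[LHS]mulmx1 -KK -!mulmxA (mulmxA H^T) (mulmxA (diag_mx _)) Eg.
by rewrite !mulmxA HH mul1mx.
Qed.

Lemma is_eigdec_eigdec S p : is_eigdec S p -> is_eigdec S (eigdec S).
Proof. by move=> Sp; apply: (xgetPex (1%:M, 0)); exists p. Qed.

Lemma logmxE S H lam : is_eigdec S (H, lam) ->
  logmx S = H *m diag_mx (map_mx (@ln R) lam) *m H^T.
Proof.
move=> Sp; have := is_eigdec_eigdec Sp; rewrite /logmx.
by case: (eigdec S) => K m Sq; exact: (eigdec_fun_uniq (@ln R) Sq Sp).
Qed.

Lemma calJE S H lam M : is_eigdec S (H, lam) -> calJ S M = calJ_of H lam M.
Proof.
move=> Sp; have := is_eigdec_eigdec Sp; rewrite /calJ.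
case: (eigdec S) => K m Sq; rewrite /calJ_of; congr (_ + _ * _).
pose g (l : 'rV[R]_d) y := \sum_i l 0 i * log_dd y (l 0 i).
have trE (G : 'M[R]_d) (l : 'rV[R]_d) (N : 'M[R]_d) (h : R -> R) :
    \sum_i h (l 0 i) * (G^T *m N *m G) i i =
    \tr (N *m (G *m diag_mx (map_mx h l) *m G^T)).
  rewrite !mulmxA [RHS]mxtrace_mulC !mulmxA mul_mx_diag.
  by apply: eq_bigr => i _; rewrite !mxE mulrC.
have gE : g lam = g m.
  apply/funext => y; pose h z := z * log_dd y z.
  have gtr (p : 'M[R]_d * 'rV[R]_d) : is_eigdec S p ->
      g p.2 y = \tr (1%:M *m (p.1 *m diag_mx (map_mx h p.2) *m p.1^T)).
    move=> [pp _]; rewrite -trE; apply: eq_bigr => i _.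
    by rewrite mulmx1 (mulmx1C pp) mxE eqxx mulr1.
  by rewrite (gtr _ Sp) (gtr _ Sq) (eigdec_fun_uniq h Sp Sq).
have sumE (G : 'M[R]_d) (l : 'rV[R]_d) :
    \sum_i \sum_j l 0 i * (G^T *m M *m G) j j * log_dd (l 0 j) (l 0 i) =
    \tr (M *m (G *m diag_mx (map_mx (g l) l) *m G^T)).
  rewrite exchange_big -trE; apply: eq_bigr => j _.
  by rewrite /g big_distrl; apply: eq_bigr => i _; rewrite mulrAC.
by rewrite !sumE gE (eigdec_fun_uniq (g m) Sp Sq).
Qed.

Definition nabla (i j : 'I_d) (f : 'M[R]_d -> R) S : R :=
  2^-1 * (1 + (i == j)%:R) * 'D_(sym_dir i j) f S.

Definition wishart_stein M (alpha : R) (f : 'M[R]_d -> R) S : R :=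
  2 * \tr ((M - S) *m \matrix_(i, j) nabla i j f S) +
  4 / alpha * \sum_i \sum_j \sum_k \sum_l
                S i j * M k l * nabla j k (nabla l i f) S.

Definition lin_probe (U : 'M[R]_d) : 'M[R]_d -> R := fun S => \tr (U *m S).
Definition quad_probe : 'M[R]_d -> R := fun S => \tr (S *m S).
Definition log_probe : 'M[R]_d -> R := fun S => \tr (S *m logmx S - S).

Definition lin_probes_and (q : 'M[R]_d -> R) : set ('M[R]_d -> R) :=
  [set f | (exists2 U, symmetric_mx U & f = lin_probe U) \/ f = q].

End Matrices.

Definition sample_mean {R : realType} {V : lmodType R} {n : nat}
  (x : 'I_n -> V) : V := n%:R^-1 *: \sum_k x k.

(* alpha != 0 only makes 4 / alpha meaningful. *)
Definition is_stein_mom {R : realType} {d n : nat}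
    (F : set ('M[R]_d -> R)) (w : 'I_n -> 'M[R]_d)
    (M : 'M[R]_d) (alpha : R) (Sigma : 'M[R]_d) : Prop :=
  [/\ symmetric_mx M, alpha != 0,
      forall f, F f -> sample_mean (fun k => wishart_stein M alpha f (w k)) = 0
    & Sigma = alpha^-1 *: M].

Section Wishart.
Context {R : realType} {d : nat}.
Local Open Scope ereal_scope.

Definition borel_mx : measurableType _ := g_sigma_algebraType (@open 'M[R]_d).

Fixpoint coord_integral (s : seq ('I_d * 'I_d)) (g : 'M[R]_d -> \bar R)
    (S : 'M[R]_d) : \bar R :=
  if s is p :: s' then
    \int[lebesgue_measure]_(x in [set: R])
      coord_integral s' g (S + x *: sym_dir p.1 p.2)%R
  else g S.

(* Integral of g >= 0 against Lebesgue measure \prod_(i <= j) dS_ij on the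
   symmetric matrices, as an iterated integral (Tonelli). *)
Definition sym_integral (g : 'M[R]_d -> \bar R) : \bar R :=
  coord_integral
    [seq p : 'I_d * 'I_d <- enum {: 'I_d * 'I_d} | (p.1 <= p.2)%N] g 0%R.

Definition pd_integral (B : set 'M[R]_d) (g : 'M[R]_d -> R) : \bar R :=
  sym_integral (fun S => if `[< posdef S /\ B S >] then (g S)%:E else 0).

(* Multivariate gamma function, for a > (d - 1) / 2. *)
Definition mv_gamma (a : R) : R :=
  fine (pd_integral setT
    (fun S => (\det S `^ (a - (d%:R + 1) / 2) * expR (- \tr S))%R)).

Definition wishart_pdf (alpha : R) (Sigma S : 'M[R]_d) : R :=
  (\det S `^ ((alpha - d%:R - 1) / 2) * expR (- \tr (invmx Sigma *m S) / 2) /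
   (2 `^ (alpha * d%:R / 2) * \det Sigma `^ (alpha / 2) *
    mv_gamma (alpha / 2)))%R.

Definition wishart_law (alpha : R) (Sigma : 'M[R]_d) (B : set 'M[R]_d) :
  \bar R := pd_integral B (wishart_pdf alpha Sigma).

End Wishart.
Arguments borel_mx : clear implicits.

Definition independent_rvs {disp disp'} {T : measurableType disp}
    {T' : measurableType disp'} {R : realType} (P : probability T R) {n : nat}
    (X : 'I_n -> {RV P >-> T'}) : Prop :=
  forall (J : {set 'I_n}) (B : 'I_n -> set T'), (forall k, measurable (B k)) ->
  P (\bigcap_(k in [set` J]) X k @^-1` B k) =
  (\prod_(k in J) P (X k @^-1` B k))%E.

Definition iid_wishart {disp} {T : measurableType disp} {R : realType}
    {d n : nat} (P : probability T R) (W : 'I_n -> {RV P >-> borel_mx R d})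
    (alpha : R) (Sigma : 'M[R]_d) : Prop :=
  independent_rvs W /\
  forall k (B : set (borel_mx R d)), measurable B ->
    distribution P (W k) B = wishart_law alpha Sigma B.

(* Main.v *)
Require Import Defs.
From mathcomp Require Import all_boot all_order all_algebra.
From mathcomp Require Import complex.
From mathcomp Require Import all_classical all_reals all_analysis.
From mathcomp Require Import ring lra.

Set Implicit Arguments.
Unset Strict Implicit.
Unset Printing Implicit Defensive.

Import Order.TTheory GRing.Theory Num.Theory.
Import numFieldNormedType.Exports.

Local Open Scope classical_set_scope.
Local Open Scope ring_scope.

(** The Wishart density lives on the positive definite cone, so almost surely
    all the sample matrices S_k are positive definite, and from there on the
    statement is deterministic.

    On the probe f_U the Stein operator is 2 tr((M - S) U), because the gradient
    of f_U is the constant U. The linear equations therefore say that M - Mhat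
    is orthogonal to every symmetric matrix, itself included, and M = Mhat
    ([stein_moment_linear_probes]). Given that, one more probe leaves an
    equation c (num / a - den) = 0 with c and num nonzero; its only solution is
    a = num / den, and this a is nonzero ([is_stein_momP]). So everything
    reduces to computing the Stein operator on the two remaining probes.

    For tr(S^2) this is algebra ([wishart_stein_quad_probe]). For
    tr(S log S - S) the gradient is log S, so the second-order part needs the
    derivative of the matrix logarithm. Let P_a be the spectral projections of
    S, with eigenvalues l_a, and let phi^[1] be the divided difference of phi.
    The increment of a spectral function is exactly

      phi(S + tE) - phi(S) = t \sum_a P_a E g_a(S + tE),  g_a := phi^[1](l_a, .),

    ([specfun_increment]), so phi is differentiable along E as soon as each g_a
    is continuous at S along the line, and the derivative is
    \sum_(a, b) phi^[1](l_a, l_b) P_a E P_b, the Daleckii-Krein formula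
    ([specfun_derive]). Continuity of g(S + tE) at t = 0 only asks that g be
    continuous at the eigenvalues of S ([specfun_cvg]): if an eigenvalue m_b of
    S + tE is far from l_a, then the corresponding eigenvectors are nearly
    orthogonal, since (m_b - l_a) times their scalar product is O(t).
    Contracting the formula for phi = ln against S and M gives calJ
    ([second_order_log_probe]).

    The numerators are positive because Mhat is positive definite, and because
    log_dd, the eigenvalues of S_k and the diagonal entries of H^T Mhat H are
    all positive. *)

(** * Real symmetric matrices are orthogonally diagonalizable *)

Lemma sqnorm_ge0 (R : realDomainType) n (x : 'rV[R]_n) : 0 <= (x *m x^T) 0 0.
Proof. by rewrite mxE sumr_ge0 // => k _; rewrite mxE -expr2 sqr_ge0. Qed.

Lemma sqnorm_eq0 (R : realDomainType) n (x : 'rV[R]_n) :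
  ((x *m x^T) 0 0 == 0) = (x == 0).
Proof.
apply/eqP/eqP => [|->]; last by rewrite mul0mx mxE.
rewrite mxE => x0; apply/rowP => k; rewrite mxE; apply/eqP.
have /eqP := x0; rewrite psumr_eq0 => [|l _]; last by rewrite mxE -expr2 sqr_ge0.
by move=> /allP /(_ k (mem_index_enum _)) /=; rewrite mxE -expr2 sqrf_eq0.
Qed.

Lemma sqnorm_gt0 (R : realDomainType) n (x : 'rV[R]_n) :
  (0 < (x *m x^T) 0 0) = (x != 0).
Proof. by rewrite lt0r sqnorm_ge0 andbT sqnorm_eq0. Qed.

(** A complex eigenvector x + iy for a + ib satisfies x A = a x - b y and
    y A = a y + b x. Comparing (x A) y^T with (y A) x^T gives
    b (|x|^2 + |y|^2) = 0, so b = 0 and x or y is a real eigenvector. *)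
Lemma symmetric_eigenvector (R : rcfType) n (A : 'M[R]_n.+1) : A^T = A ->
  exists (a : R) (v : 'rV[R]_n.+1), v != 0 /\ v *m A = a *: v.
Proof.
move=> symA; pose Ac := map_mx (real_complex R) A.
have /closed_rootP[[a b]] : size (char_poly Ac) != 1 by rewrite size_char_poly.
rewrite -eigenvalue_root_char => /eigenvalueP[v vA v0].
pose x := map_mx (@complex.Re R) v; pose y := map_mx (@complex.Im R) v.
have ReD (s t : R[i]) : complex.Re (s + t) = complex.Re s + complex.Re t.
  by case: s t => [? ?] [].
have ImD (s t : R[i]) : complex.Im (s + t) = complex.Im s + complex.Im t.
  by case: s t => [? ?] [].
have xA : x *m A = a *: x - b *: y.
  apply/rowP => j; move/rowP: vA => /(_ j)/(congr1 (@complex.Re R)).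
  rewrite !mxE (big_morph (@complex.Re R) ReD (erefl : complex.Re 0 = 0)).
  case: (v 0 j) => p q /= <-.
  apply: eq_bigr => k _; rewrite !mxE; case: (v 0 k) => p' q' /=.
  by rewrite mulr0 subr0.
have yA : y *m A = a *: y + b *: x.
  apply/rowP => j; move/rowP: vA => /(_ j)/(congr1 (@complex.Im R)).
  rewrite !mxE (big_morph (@complex.Im R) ImD (erefl : complex.Im 0 = 0)).
  case: (v 0 j) => p q /= <-.
  apply: eq_bigr => k _; rewrite !mxE; case: (v 0 k) => p' q' /=.
  by rewrite mulr0 add0r.
have xyA : x *m A *m y^T = (y *m A *m x^T)^T.
  by rewrite !trmx_mul trmxK symA mulmxA.
have xy0 : (x != 0) || (y != 0).
  rewrite -negb_and; apply: contra v0 => /andP[/eqP x0 /eqP y0].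
  apply/eqP/rowP => k; move/rowP: x0 => /(_ k); move/rowP: y0 => /(_ k).
  by rewrite !mxE; case: (v 0 k) => p q /= -> ->.
have b0 : b = 0.
  have sxy : (y *m x^T) 0 0 = (x *m y^T) 0 0.
    by rewrite -[y *m x^T]trmxK trmx_mul trmxK mxE.
  have := congr1 (fun M : 'M[R]_1 => M 0 0) xyA.
  rewrite [RHS]mxE xA yA mulmxBl mulmxDl -!scalemxAl.
  set xx := x *m x^T; set yy := y *m y^T; set xy := x *m y^T.
  set yx := y *m x^T => H.
  have {H} : b * (xx 0 0 + yy 0 0) = 0.
    have addE (M N : 'M[R]_1) : (M + N) 0 0 = M 0 0 + N 0 0 by rewrite mxE.
    have scaleE k (M : 'M[R]_1) : (k *: M) 0 0 = k * M 0 0 by rewrite mxE.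
    move: H; rewrite -scaleNr !addE !scaleE sxy; lra.
  move/eqP; rewrite mulf_eq0 => /orP[/eqP//|].
  rewrite gt_eqF //; case/orP: xy0 => h.
    by rewrite ltr_wpDr ?sqnorm_ge0 ?sqnorm_gt0.
  by rewrite ltr_wpDl ?sqnorm_ge0 ?sqnorm_gt0.
exists a; case/orP: xy0 => h; [exists x|exists y]; split => //.
  by rewrite xA b0 scale0r subr0.
by rewrite yA b0 scale0r addr0.
Qed.

(** The reflection in the hyperplane orthogonal to e - v exchanges the unit
    vectors e and v. It is what extends a unit eigenvector to an orthogonal
    matrix. *)
Lemma householder (R : realFieldType) n (e v : 'rV[R]_n) :
  e *m e^T = 1%:M -> v *m v^T = 1%:M ->
  exists H : 'M[R]_n, [/\ H^T = H, H *m H = 1%:M & e *m H = v].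
Proof.
move=> ee vv.
have [->|nev] := eqVneq e v.
  by exists 1%:M; rewrite trmx1 !mulmx1.
pose u : 'rV[R]_n := e - v; pose c : R := (u *m u^T) 0 0.
have c0 : c != 0 by rewrite gt_eqF // sqnorm_gt0 subr_eq0.
have uu : u *m u^T = c%:M by rewrite [LHS]mx11_scalar.
pose H : 'M[R]_n := 1%:M - (2 / c) *: (u^T *m u).
exists H; split.
- by rewrite /H linearB /= trmx1 linearZ /= trmx_mul trmxK.
- rewrite /H mulmxBr mulmx1 mulmxBl mul1mx -scalemxAl -scalemxAr scalerA.
  rewrite mulmxA -(mulmxA _ u) uu mul_mx_scalar -scalemxAl scalerA.
  rewrite -mulrA divfK // -addrA -opprD.
  have cE : 2 / c - 2 / c * 2 = - (2 / c) by ring.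
  by rewrite -scalerBl cE scaleNr subrr subr0.
- have ev : v *m e^T = e *m v^T.
    by rewrite -[LHS]trmxK trmx_mul trmxK [e *m _]mx11_scalar tr_scalar_mx.
  have eu : (e *m u^T) = (c / 2)%:M.
    have : u *m u^T = 2 *: (e *m u^T).
      rewrite /u linearB /= !mulmxBr !mulmxBl ee vv ev.
      by rewrite scaler_nat opprB mulr2n.
    rewrite uu => /(congr1 (fun M => 2^-1 *: M)).
    by rewrite scalerA mulVf ?pnatr_eq0 // scale1r scale_scalar_mx mulrC.
  rewrite /H mulmxBr mulmx1 -scalemxAr mulmxA eu mul_scalar_mx scalerA.
  by rewrite mulrA divfK // divff ?pnatr_eq0 // scale1r /u opprB addrCA subrr addr0.
Qed.

(** Induction on the size: a reflection moves a unit eigenvector onto the first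
    basis vector, and symmetry then makes the matrix block diagonal. *)
Lemma symmetric_spectral (R : rcfType) n (A : 'M[R]_n) : A^T = A ->
  exists (H : 'M[R]_n) (l : 'rV[R]_n),
    H *m H^T = 1%:M /\ A = H *m diag_mx l *m H^T.
Proof.
elim: n A => [|n IHn] A symA.
  by exists 1%:M, 0; split; apply/matrixP => -[].
have [a [w [w0 wA]]] := symmetric_eigenvector (A := A) symA.
pose c := Num.sqrt ((w *m w^T) 0 0).
have c0 : 0 < c by rewrite sqrtr_gt0 sqnorm_gt0.
pose v := c^-1 *: w.
have vv : v *m v^T = 1%:M.
  rewrite /v linearZ /= -scalemxAl -scalemxAr scalerA [w *m _]mx11_scalar.
  rewrite scale_scalar_mx -[X in _ * X]sqr_sqrtr ?sqnorm_ge0 // -/c.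
  by rewrite -invfM -expr2 mulVf ?expf_neq0 // gt_eqF.
have vA : v *m A = a *: v by rewrite -scalemxAl wA scalerA mulrC -scalerA.
pose e : 'rV[R]_n.+1 := delta_mx 0 0.
have ee : e *m e^T = 1%:M.
  by rewrite trmx_delta mul_delta_mx; apply/matrixP => i j; rewrite !mxE !ord1.
have [H [Ht HH eH]] := householder ee vv.
have [B defB] : {B : 'M[R]_(1 + n) | B = H *m A *m H} by exists (H *m A *m H).
have Bt : B^T = B by rewrite defB !trmx_mul Ht symA mulmxA.
have eB : e *m B = a *: e.
  by rewrite defB !mulmxA eH vA -scalemxAl -eH -mulmxA HH mulmx1.
have B0 j : B 0 j = a * (j == 0)%:R.
  move/rowP: eB => /(_ j); rewrite -rowE !mxE => ->.
  by rewrite eqxx andTb.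
have urB : ursubmx B = 0.
  apply/matrixP => i j; rewrite !mxE !ord1.
  have -> : lshift n 0 = 0 :> 'I_(1 + n) by apply/val_inj.
  by rewrite B0 -(inj_eq val_inj) /= mulr0.
have ulB : ulsubmx B = a%:M.
  apply/matrixP => i j; rewrite !mxE !ord1.
  have -> : lshift n 0 = 0 :> 'I_(1 + n) by apply/val_inj.
  by rewrite B0 eqxx mulr1.
have dlB : dlsubmx B = 0 by rewrite -[B]Bt -trmx_ursub urB trmx0.
have [|K [l [KK DK]]] := IHn (drsubmx B); first by rewrite trmx_drsub Bt.
pose L : 'M[R]_(1 + n) := block_mx 1%:M 0 0 K.
pose m : 'rV[R]_(1 + n) := row_mx a%:M l.
have LL : L *m L^T = 1%:M.
  rewrite tr_block_mx !trmx0 trmx1 mulmx_block !mulmx0 !mul0mx !addr0 !add0r.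
  by rewrite mulmx1 KK -scalar_mx_block.
have BE : B = L *m diag_mx m *m L^T.
  rewrite -[LHS]submxK ulB urB dlB DK diag_mx_row tr_block_mx !mulmx_block.
  rewrite !trmx0 !trmx1 !mulmx0 !mul0mx !addr0 !add0r ?mulmx0.
  rewrite ?mul0mx ?mulmx1 ?mul1mx ?addr0 ?add0r.
  congr (block_mx _ _ _ _).
  by apply/matrixP => i j; rewrite !mxE !ord1.
exists (H *m L), m; split.
  by rewrite trmx_mul mulmxA -(mulmxA H) LL mulmx1 Ht.
rewrite trmx_mul Ht !mulmxA -(mulmxA H) -(mulmxA H) -BE defB.
by rewrite !mulmxA HH mul1mx -mulmxA HH mulmx1.
Qed.

(** * Spectral functions along a line of symmetric matrices *)

Lemma symmetric_entry (R : realType) d (S : 'M[R]_d) i j :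
  symmetric_mx S -> S i j = S j i.
Proof. by move=> Ssym; rewrite -[in LHS]Ssym mxE. Qed.

Lemma symmetric_line (R : realType) d (E S : 'M[R]_d) t :
  symmetric_mx E -> symmetric_mx S -> symmetric_mx (t *: E + S).
Proof. by move=> Esym Ssym; rewrite /symmetric_mx linearD linearZ /= Esym Ssym. Qed.

(** The spectral function g(S) of a symmetric matrix; [specfun ln] is
    convertible to [logmx]. *)
Definition specfun {R : realType} {d : nat} (g : R -> R) (S : 'M[R]_d) : 'M[R]_d :=
  let: (H, l) := eigdec S in H *m diag_mx (map_mx g l) *m H^T.

Lemma specfunE (R : realType) d (g : R -> R) (S H : 'M[R]_d) l :
  is_eigdec S (H, l) -> specfun g S = H *m diag_mx (map_mx g l) *m H^T.
Proof.
move=> Sp; have := is_eigdec_eigdec Sp; rewrite /specfun.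
by case: (eigdec S) => K m Sq; exact: (eigdec_fun_uniq g Sq Sp).
Qed.

Lemma symmetric_is_eigdec (R : realType) d (S : 'M[R]_d) :
  symmetric_mx S -> exists p, is_eigdec S p.
Proof.
by move=> /symmetric_spectral[H [l [HH SE]]]; exists (H, l).
Qed.

Lemma is_eigdec_sym (R : realType) d (S : 'M[R]_d) p :
  is_eigdec S p -> symmetric_mx S.
Proof.
by case=> _ ->; rewrite /symmetric_mx !trmx_mul trmxK tr_diag_mx mulmxA.
Qed.

Lemma orthogonal_entry_le1 (R : realType) d (H : 'M[R]_d) i j :
  H *m H^T = 1%:M -> `|H i j| <= 1.
Proof.
move=> /matrixP/(_ i i); rewrite !mxE eqxx mulr1n => HH.
rewrite -(@expr_le1 _ 2) // real_normK ?num_real // -HH (bigD1 j) //= mxE -expr2.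
by rewrite lerDl sumr_ge0 // => k _; rewrite mxE -expr2 sqr_ge0.
Qed.

(** The difference of two matrices, written between an eigenbasis of the one
    and an eigenbasis of the other, is entrywise the difference of eigenvalues
    times the overlap H^T K of the bases. All the perturbation estimates start
    from this. *)
Lemma conj_diag_entry (R : realType) d (H K : 'M[R]_d) (f g : 'rV[R]_d) a b :
  H^T *m H = 1%:M -> K^T *m K = 1%:M ->
  (H^T *m (K *m diag_mx g *m K^T - H *m diag_mx f *m H^T) *m K) a b =
  (g 0 b - f 0 a) * (H^T *m K) a b.
Proof.
move=> HH KK; rewrite mulmxBr mulmxBl !mulmxA HH mul1mx.
rewrite -(mulmxA (H^T *m K *m _)) KK mulmx1 -(mulmxA (diag_mx f)).
by rewrite mul_diag_mx mul_mx_diag !mxE; ring.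
Qed.

Section Perturbation.
Context {R : realType} {d : nat} {S E H : 'M[R]_d} {l : 'rV[R]_d}.
Hypothesis (SHl : is_eigdec S (H, l)).

Let HHt : H *m H^T = 1%:M. Proof. by case: SHl. Qed.
Let HtH : H^T *m H = 1%:M. Proof. exact: mulmx1C. Qed.
Let SE : S = H *m diag_mx l *m H^T. Proof. by case: SHl. Qed.

Lemma eigengap_entry t (K : 'M[R]_d) m a b :
  is_eigdec (t *: E + S) (K, m) ->
  (m 0 b - l 0 a) * (H^T *m K) a b = t * (H^T *m E *m K) a b.
Proof.
move=> [/= /mulmx1C KK SK].
rewrite -conj_diag_entry // -SK -SE addrK.
by rewrite -scalemxAr -scalemxAl mxE.
Qed.

(* Any bound of the entries of H^T E K that is uniform in K would do. *)
Let N : R := \sum_i \sum_j `|E i j|.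

Lemma eigengap_bound t (K : 'M[R]_d) m a b :
  is_eigdec (t *: E + S) (K, m) ->
  `|(m 0 b - l 0 a) * (H^T *m K) a b| <= `|t| * N.
Proof.
move=> SK; rewrite (eigengap_entry _ _ SK) normrM ler_wpM2l //.
rewrite mxE /N exchange_big; apply: (le_trans (ler_norm_sum _ _ _)).
apply: ler_sum => j _; rewrite normrM.
apply: (@le_trans _ _ `|(H^T *m E) a j|).
  by rewrite ler_piMr // orthogonal_entry_le1 //; case: SK.
rewrite mxE; apply: (le_trans (ler_norm_sum _ _ _)).
by apply: ler_sum => i _; rewrite normrM mxE ler_piMl // orthogonal_entry_le1.
Qed.

Lemma overlap_orthogonal t (K : 'M[R]_d) m :
  is_eigdec (t *: E + S) (K, m) -> (H^T *m K) *m (H^T *m K)^T = 1%:M.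
Proof.
move=> [/= KK _]; rewrite trmx_mul trmxK mulmxA -(mulmxA H^T) KK mulmx1.
exact: HtH.
Qed.

Let N_ge0 : 0 <= N.
Proof. by apply: sumr_ge0 => i _; apply: sumr_ge0. Qed.

(** The overlaps of an eigenvector of t E + S with an orthonormal eigenbasis of
    S have squares that add up to 1, so they cannot all be small; but each is
    O(t / delta) if the eigenvalue stays delta away from all those of S. *)
Lemma eigenvalue_near (delta : R) : 0 < delta ->
  exists2 eta, 0 < eta & forall t, `|t| < eta ->
    forall K m, is_eigdec (t *: E + S) (K, m) ->
    forall b, exists a, `|m 0 b - l 0 a| < delta.
Proof.
move=> delta0; exists (delta / (d.+1%:R * (N + 1))).
  by rewrite divr_gt0 // mulr_gt0 ?ltr0n // ltr_wpDl.
move=> t te K m SK b; apply/not_existsP => far.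
set C := H^T *m K.
have CC : C^T *m C = 1%:M by apply: mulmx1C; exact: overlap_orthogonal SK.
have Cle a b' : `|C a b'| <= 1.
  by apply: orthogonal_entry_le1; exact: overlap_orthogonal SK.
(* Summed over a, this bounds 1 = \sum_a (C a b)^2 by d / (d + 1). *)
have Csmall a : `|C a b| <= d.+1%:R^-1.
  have := eigengap_bound a b SK; rewrite -/C normrM => le1.
  have dab : delta <= `|m 0 b - l 0 a| by rewrite leNgt; apply/negP/far.
  rewrite -(@ler_pM2l _ delta) //.
  apply: (le_trans (ler_wpM2r (normr_ge0 _) dab)).
  apply: (le_trans le1).
  apply: (@le_trans _ _ (`|t| * (N + 1))); first by rewrite ler_wpM2l // lerDl.
  move: te; rewrite lter_pdivlMr ?mulr_gt0 ?ltr0n // ?ltr_wpDl // => te.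
  by rewrite ler_pdivlMr ?ltr0n // -mulrA [_ * d.+1%:R]mulrC ltW.
have : 1 <= d%:R / d.+1%:R :> R.
  rewrite [leLHS](_ : 1 = (C^T *m C) b b); last by rewrite CC mxE eqxx.
  rewrite mxE; apply: (@le_trans _ _ (\sum_(a < d) (d.+1%:R^-1 : R))).
    apply: ler_sum => a _; rewrite mxE; apply: le_trans (Csmall a).
    by rewrite (le_trans (ler_norm _)) // normrM ler_piMl.
  by rewrite sumr_const card_ord -[leLHS]mulr_natl.
by rewrite ler_pdivlMr ?ltr0n // mul1r ler_nat ltnn.
Qed.

Lemma finite_uniform_continuity (g : R -> R) (e : R) : 0 < e ->
  (forall a, {for l 0 a, continuous g}) ->
  exists2 delta, 0 < delta & forall a y, `|y - l 0 a| < delta ->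
    `|g y - g (l 0 a)| < e.
Proof.
move=> e0 gc.
have : \forall del \near 0^'+, forall a y, `|y - l 0 a| < del ->
    `|g y - g (l 0 a)| < e.
  apply: filter_forall => a.
  have /cvgrPdist_lt/(_ e e0)/nbhs_ballP[r /= r0 rP] := gc a.
  near=> del => y yl; rewrite distrC; apply: rP => /=.
  rewrite /ball /= distrC; apply: lt_le_trans yl _.
  by near: del; exact: nbhs_right_le.
move=> H1.
have H0 : \forall del \near (0:R)^'+, 0 < del by exact: nbhs_right_gt.
by have [del [? ?]] := filter_ex (filterI H0 H1); exists del.
Unshelve. all: by end_near. Qed.

(** Either the two eigenvalues are close and continuity of g at l_a bounds the
    first factor, or they are far apart and the overlap of the eigenvectors is
    small; in the second case g is still bounded, since the eigenvalues of
    t E + S are near those of S. *)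
Lemma specfun_gap (g : R -> R) (e : R) : 0 < e ->
  (forall a, {for l 0 a, continuous g}) ->
  exists2 eta, 0 < eta & forall t, `|t| < eta ->
    forall K m, is_eigdec (t *: E + S) (K, m) ->
    forall a b, `|(g (m 0 b) - g (l 0 a)) * (H^T *m K) a b| <= e.
Proof.
move=> e0 gc.
have [delta delta0 gdelta] := finite_uniform_continuity e0 gc.
have [eta1 eta10 near1] := eigenvalue_near delta0.
pose B := \sum_a `|g (l 0 a)|.
have B_ge a : `|g (l 0 a)| <= B.
  by rewrite /B (bigD1 a) //= lerDl sumr_ge0.
have B0 : 0 <= B by exact: sumr_ge0.
have D0 : 0 < e + 2 * B by rewrite ltr_wpDr // mulr_ge0.
have N1 : 0 < N + 1 by rewrite ltr_wpDl.
(* With this choice (e + 2 B) |t| (N + 1) < e delta, the bound required when the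
   eigenvalues are at least delta apart. *)
exists (Num.min eta1 (e * delta / ((e + 2 * B) * (N + 1)))).
  by rewrite lt_min eta10 divr_gt0 // mulr_gt0.
move=> t; rewrite lt_min => /andP[/near1 {}near1].
rewrite lter_pdivlMr ?mulr_gt0 // => te K m SK a b.
have [c mc] := near1 K m SK b.
have Cle : `|(H^T *m K) a b| <= 1.
  by apply: orthogonal_entry_le1; exact: overlap_orthogonal SK.
have := eigengap_bound a b SK; rewrite !normrM.
have [close _|far le1] := ltP `|m 0 b - l 0 a| delta.
  by rewrite -[leRHS]mulr1 ler_pM // ltW // gdelta.
have gle : `|g (m 0 b) - g (l 0 a)| <= e + 2 * B.
  have -> : g (m 0 b) - g (l 0 a) =
     (g (m 0 b) - g (l 0 c)) + (g (l 0 c) - g (l 0 a)) by ring.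
  rewrite (le_trans (ler_normD _ _)) // lerD //; first by rewrite ltW // gdelta.
  by rewrite (le_trans (ler_normB _ _)) // mulr_natl mulr2n lerD.
rewrite -(@ler_pM2l _ delta) // mulrCA.
apply: (@le_trans _ _ ((e + 2 * B) * (`|t| * (N + 1)))).
  apply: ler_pM => //; first by rewrite mulr_ge0 // ltW.
  apply: (le_trans (ler_wpM2r (normr_ge0 _) far)).
  by apply: (le_trans le1); rewrite ler_wpM2l // lerDl.
by rewrite mulrCA [leRHS]mulrC ltW.
Qed.

Hypothesis Esym : symmetric_mx E.

Let path_eigdec t : exists p, is_eigdec (t *: E + S) p.
Proof.
by apply/symmetric_is_eigdec/symmetric_line => //; exact: is_eigdec_sym SHl.
Qed.

Lemma specfun_cvg (g : R -> R) i j : (forall a, {for l 0 a, continuous g}) ->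
  specfun g (t *: E + S) i j @[t --> 0] --> specfun g S i j.
Proof.
move=> gc; apply/cvgrPdist_le => e e0.
have e'0 : 0 < e / (d%:R * d%:R + 1).
  by rewrite divr_gt0 // ltr_wpDl // mulr_ge0.
have [eta eta0 etaP] := specfun_gap e'0 gc.
apply/nbhs_ballP; exists eta => //= t; rewrite /ball /= sub0r normrN => te.
have [[K m] SK] := path_eigdec t; have [/= KK _] := SK.
rewrite (specfunE _ SHl) (specfunE _ SK) distrC.
set A := K *m _ *m _; set B := H *m _ *m _.
have -> : A i j - B i j = (H *m (H^T *m (A - B) *m K) *m K^T) i j.
  by rewrite !mulmxA HHt mul1mx -mulmxA KK mulmx1 !mxE.
set X := _ *m K.
have Xle a b : `|X a b| <= e / (d%:R * d%:R + 1).
  rewrite /X conj_diag_entry ?(mulmx1C KK) //.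
  by rewrite ![map_mx _ _ _ _]mxE; exact: (etaP _ te).
rewrite mxE.
apply: (@le_trans _ _ (\sum_(b < d) \sum_(a < d) e / (d%:R * d%:R + 1))).
  apply: (le_trans (ler_norm_sum _ _ _)); apply: ler_sum => b _.
  rewrite normrM; apply: (@le_trans _ _ `|(H *m X) i b|).
    by rewrite [K^T _ _]mxE ler_piMr // orthogonal_entry_le1.
  rewrite mxE; apply: (le_trans (ler_norm_sum _ _ _)); apply: ler_sum => a _.
  rewrite normrM; apply: le_trans (Xle a b).
  by rewrite ler_piMl // orthogonal_entry_le1.
rewrite !sumr_const card_ord -mulrnA -[leLHS]mulr_natl natrM mulrCA.
by rewrite ler_piMr ?(ltW e0) // ler_pdivrMr ?mul1r ?lerDl //.
Qed.

End Perturbation.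

(** * Divided differences and the Daleckii-Krein formula *)

Definition div_diff {R : realType} (phi dphi : R -> R) (x y : R) : R :=
  if x == y then dphi x else (phi x - phi y) / (x - y).

Lemma div_diffM (R : realType) (phi dphi : R -> R) (x y : R) :
  div_diff phi dphi x y * (x - y) = phi x - phi y.
Proof.
rewrite /div_diff; have [->|xy] := eqVneq x y; first by rewrite !subrr mulr0.
by rewrite divfK // subr_eq0.
Qed.

(** Where y differs from x this is continuity of phi; at y = x it is the
    definition of the derivative. *)
Lemma div_diff_continuous (R : realType) (phi dphi : R -> R) (x y : R) :
  is_derive x 1 phi (dphi x) -> {for y, continuous phi} ->
  {for y, continuous (div_diff phi dphi x)}.
Proof.
move=> dx cy; have [<-|xy] := eqVneq x y.
  apply/continuous_withinNx; rewrite /= {2}/div_diff eqxx.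
  have [/cvgrPdist_le dc dE] := dx.
  have {}dE : dphi x =
      lim (h^-1 *: ((phi \o shift x) (h *: 1) - phi x) @[h --> 0^']).
    by rewrite -dE.
  rewrite -dE in dc.
  apply/cvgrPdist_le => e /dc; rewrite !near_withinE => /nbhs_ballP[r /= r0 rP].
  apply/nbhs_ballP; exists r => //= z; rewrite /ball /= => xz zx.
  have zx0 : z - x != 0 by rewrite subr_eq0.
  have := rP (z - x); rewrite /ball /= sub0r opprB => /(_ xz zx0).
  rewrite /GRing.scale /= mulr1 subrK; congr (`| _ - _ | <= _).
  rewrite /div_diff eq_sym (negbTE zx) -[x - z]opprB invrN mulrN -mulNr opprB.
  by rewrite mulrC.
have nbx : \forall z \near y, x != z.
  apply/nbhs_ballP; exists `|x - y|; first by rewrite /= normr_gt0 subr_eq0.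
  by move=> z /=; apply: contraTN => /eqP <-; rewrite /ball /= distrC ltxx.
rewrite /prop_for /continuous_at.
have -> : div_diff phi dphi x y = (phi x - phi y) / (x - y).
  by rewrite /div_diff (negbTE xy).
apply: (@cvg_trans _ ((fun z => (phi x - phi z) / (x - z)) @ y)).
  apply: near_eq_cvg; near=> z.
  rewrite /div_diff; case: eqP => // xz.
  have : x != z by near: z.
  by rewrite xz eqxx.
have phid : phi x - phi z @[z --> y] --> phi x - phi y.
  by apply: cvgB; [exact: cvg_cst | exact: cy].
have xd : x - z @[z --> y] --> x - y.
  by apply: cvgB; [exact: cvg_cst | exact: cvg_id].
by apply: (cvgM phid (cvgV _ xd)); rewrite subr_eq0.
Unshelve. all: by end_near. Qed.

Lemma diag_mx_delta (R : pzRingType) d (c : 'I_d) :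
  diag_mx (delta_mx 0 c) = delta_mx c c :> 'M[R]_d.
Proof.
rewrite diag_mx_sum_delta (bigD1 c) //= big1 ?addr0 => [|k kc].
  by rewrite mxE !eqxx scale1r.
by rewrite mxE (negbTE kc) scale0r.
Qed.

Lemma cvg_sumr (R : realType) (I T : Type) (F : set_system T) {FF : Filter F}
    (r : seq I) (P : pred I) (f : I -> T -> R) (a : I -> R) :
  (forall i, P i -> f i x @[x --> F] --> a i) ->
  \sum_(i <- r | P i) f i x @[x --> F] --> \sum_(i <- r | P i) a i.
Proof. by move=> fa; apply: cvg_big => //; exact: add_continuous. Qed.

Section DaleckiiKrein.
Context {R : realType} {d : nat} {S E H : 'M[R]_d} {l : 'rV[R]_d}.
Variables (phi dphi : R -> R).
Hypothesis (SHl : is_eigdec S (H, l)) (Esym : symmetric_mx E).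
Hypothesis (phi' : forall a, is_derive (l 0 a) 1 phi (dphi (l 0 a))).

Let HtH : H^T *m H = 1%:M. Proof. by case: SHl => /mulmx1C. Qed.

Let path_eigdec t : exists p, is_eigdec (t *: E + S) p.
Proof.
by apply/symmetric_is_eigdec/symmetric_line => //; exact: is_eigdec_sym SHl.
Qed.

(** Between an eigenbasis of S and one of t E + S, both sides have entries
    phi^[1](l_a, m_b) (m_b - l_a) times the overlap of the bases, by
    [eigengap_entry]. The identity is exact, and all the dependence on t sits in
    spectral functions of t E + S. *)
Lemma specfun_increment t :
  specfun phi (t *: E + S) - specfun phi S =
  t *: \sum_a (H *m delta_mx a a *m H^T *m E *m
               specfun (div_diff phi dphi (l 0 a)) (t *: E + S)).
Proof.
have [[K m] SK] := path_eigdec t; have [/= KK _] := SK.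
have HH : H *m H^T = 1%:M by case: SHl.
have KtK := mulmx1C KK.
suff EQ : H^T *m (specfun phi (t *: E + S) - specfun phi S) *m K =
  H^T *m (t *: \sum_a (H *m delta_mx a a *m H^T *m E *m
               specfun (div_diff phi dphi (l 0 a)) (t *: E + S))) *m K.
  have := congr1 (fun X => H *m X *m K^T) EQ.
  by rewrite !mulmxA HH !mul1mx -!mulmxA KK !mulmx1.
apply/matrixP => a b.
rewrite (specfunE _ SHl) (specfunE _ SK) conj_diag_entry //.
rewrite ![map_mx _ _ _ _]mxE -scalemxAr -scalemxAl [RHS]mxE.
have termE c (g : 'rV[R]_d) :
    (H^T *m (H *m delta_mx c c *m H^T *m E *m (K *m diag_mx g *m K^T)) *m K) a b =
    (a == c)%:R * ((H^T *m E *m K) a b * g 0 b).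
  rewrite !mulmxA HtH mul1mx -(mulmxA _ K^T) KtK mulmx1 -!mulmxA.
  rewrite -diag_mx_delta mul_diag_mx [LHS]mxE [delta_mx _ _ _ _]mxE eqxx /=.
  by rewrite !mulmxA mul_mx_diag [(\matrix_(_, _) _) _ _]mxE.
rewrite mulmx_sumr mulmx_suml summxE (bigD1 a) //= big1 ?addr0; last first.
  by move=> c ca; rewrite (specfunE _ SK) termE eq_sym (negbTE ca) mul0r.
rewrite (specfunE _ SK) termE eqxx mul1r [map_mx _ _ _ _]mxE mulrA.
rewrite -(eigengap_entry SHl _ _ SK) -opprB -(div_diffM phi dphi).
by rewrite -mulrN opprB; ring.
Qed.

(** The (i, j) entry of H (Phi o (H^T E H)) H^T, where o is the entrywise
    product and Phi is the matrix of divided differences of phi at the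
    eigenvalues of S. *)
Definition daleckii_krein i j : R :=
  \sum_a \sum_b H i a * (H^T *m E *m H) a b *
     div_diff phi dphi (l 0 a) (l 0 b) * H j b.

Lemma daleckii_kreinE i j : daleckii_krein i j =
  (\sum_a (H *m delta_mx a a *m H^T *m E *m
     specfun (div_diff phi dphi (l 0 a)) S)) i j.
Proof.
rewrite summxE; apply: eq_bigr => a _.
rewrite (specfunE _ SHl) !mulmxA mxE; apply: eq_bigr => b _.
rewrite mul_mx_diag [(\matrix_(_, _) _) _ _]mxE [H^T b j]mxE [map_mx _ _ _ _]mxE.
congr (_ * _ * _); rewrite -!mulmxA [RHS]mxE (bigD1 a) //= big1 ?addr0.
  rewrite -diag_mx_delta mul_diag_mx [(\matrix_(_, _) _) _ _]mxE.
  by rewrite [delta_mx _ _ _ _]mxE !eqxx mul1r.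
move=> c ca; rewrite -diag_mx_delta mul_diag_mx [(\matrix_(_, _) _) _ _]mxE.
by rewrite [delta_mx _ _ _ _]mxE eqxx (negbTE ca) mul0r mulr0.
Qed.

Lemma specfun_derive i j :
  t^-1 * (specfun phi (t *: E + S) i j - specfun phi S i j) @[t --> 0^'] -->
  daleckii_krein i j.
Proof.
pose F (t : R) := (\sum_a (H *m delta_mx a a *m H^T *m E *m
     specfun (div_diff phi dphi (l 0 a)) (t *: E + S))) i j.
have phic a : {for l 0 a, continuous phi}.
  have [h _] := phi' a.
  by apply: differentiable_continuous; apply/derivable1_diffP.
apply: (@cvg_trans _ (F @ 0^')).
  apply: near_eq_cvg; rewrite near_withinE; near=> t => t0.
  have -> : specfun phi (t *: E + S) i j - specfun phi S i j =
    (specfun phi (t *: E + S) - specfun phi S) i j by rewrite !mxE.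
  by rewrite specfun_increment [in RHS]mxE mulrA mulVf // mul1r.
apply: cvg_within_filter; rewrite daleckii_kreinE.
have FE t : F t = \sum_a \sum_k (H *m delta_mx a a *m H^T *m E) i k *
     specfun (div_diff phi dphi (l 0 a)) (t *: E + S) k j.
  by rewrite /F summxE; apply: eq_bigr => a _; rewrite mxE.
rewrite (funext FE) summxE; apply: cvg_sumr => a _; rewrite [X in _ --> X]mxE.
apply: cvg_sumr => k _; apply: cvgM; first exact: cvg_cst.
apply: (specfun_cvg SHl Esym) => b.
exact: div_diff_continuous.
Unshelve. all: by end_near. Qed.

(** Under the trace only the diagonal divided differences phi'(l_a) survive, by
    orthogonality of H. *)
Lemma trace_daleckii_krein :
  \sum_i daleckii_krein i i = \tr (specfun dphi S *m E).
Proof.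
rewrite (specfunE _ SHl) /daleckii_krein.
transitivity (\sum_a \sum_b (H^T *m E *m H) a b *
   div_diff phi dphi (l 0 a) (l 0 b) * (H^T *m H) a b).
  rewrite exchange_big; apply: eq_bigr => a _.
  rewrite exchange_big; apply: eq_bigr => b _.
  rewrite [X in _ = _ * X]mxE big_distrr; apply: eq_bigr => i _.
  by rewrite [H^T a i]mxE /=; ring.
rewrite HtH -!mulmxA mxtrace_mulC -!mulmxA mul_diag_mx; apply: eq_bigr => a _.
rewrite (bigD1 a) //= big1 ?addr0 => [|b ba].
  rewrite /div_diff eqxx [X in _ * X]mxE eqxx mulr1 mulrC.
  by rewrite [RHS]mxE [map_mx _ _ _ _]mxE.
by rewrite [X in _ * X]mxE eq_sym (negbTE ba) mulr0.
Qed.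

Lemma trace_specfun_derive :
  t^-1 * (\tr (specfun phi (t *: E + S)) - \tr (specfun phi S)) @[t --> 0^'] -->
  \tr (specfun dphi S *m E).
Proof.
rewrite -trace_daleckii_krein.
have -> : (fun t : R =>
    t^-1 * (\tr (specfun phi (t *: E + S)) - \tr (specfun phi S))) =
  (fun t => \sum_i t^-1 * (specfun phi (t *: E + S) i i - specfun phi S i i)).
  by apply/funext => t; rewrite -big_distrr /= sumrB.
by apply: cvg_sumr => i _; exact: specfun_derive.
Qed.

End DaleckiiKrein.

(** * The Stein operator on linear and quadratic probes *)

Lemma derive_val_cvg (R : realType) d (f : 'M[R]_d -> R) S v L :
  t^-1 * (f (t *: v + S) - f S) @[t --> 0^'] --> L -> 'D_v f S = L.
Proof. by move=> fL; apply: cvg_lim => //; exact: Rhausdorff. Qed.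

(** The weight (1 + delta_ij) / 2 of [nabla] turns [sym_dir i j] into the
    symmetrization of [delta_mx i j] / 2 both on and off the diagonal, so a
    linear directional derivative can be evaluated on matrix units. *)
Lemma nabla_cvg (R : realType) d (f L : 'M[R]_d -> R) S i j :
  scalar L ->
  t^-1 * (f (t *: sym_dir i j + S) - f S) @[t --> 0^'] --> L (sym_dir i j) ->
  nabla i j f S = 2^-1 * (L (delta_mx i j) + L (delta_mx j i)).
Proof.
move=> linL /derive_val_cvg; rewrite /nabla => ->; rewrite -mulrA; congr (_ * _).
have LD A B : L (A + B) = L A + L B by rewrite -[A]scale1r linL mul1r scale1r.
rewrite /sym_dir; case: eqVneq => [->|_] /=.
  by rewrite mulrDl !mul1r.
by rewrite addr0 mul1r LD.
Qed.

Lemma trace_mul_delta (R : pzRingType) d (A : 'M[R]_d) i j :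
  \tr (A *m delta_mx i j) = A j i.
Proof.
rewrite /mxtrace (bigD1 j) //= big1 ?addr0 => [|k kj]; last first.
  rewrite mxE big1 // => l _.
  by rewrite mxE (negbTE kj) andbF mulr0.
rewrite mxE (bigD1 i) //= big1 ?addr0 => [|k ki].
  by rewrite mxE !eqxx mulr1.
by rewrite mxE (negbTE ki) mulr0.
Qed.

Lemma scalar_trace (R : comPzRingType) d (A : 'M[R]_d) (c : R) :
  scalar (fun E : 'M[R]_d => c * \tr (A *m E)).
Proof. by move=> a u v; rewrite mulmxDr -scalemxAr linearD linearZ /=; ring. Qed.

Lemma sym_dir_sym (R : realType) d (i j : 'I_d) : symmetric_mx (@sym_dir R d i j).
Proof.
rewrite /symmetric_mx /sym_dir; case: eqP => _; first by rewrite trmx_delta.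
by rewrite linearD /= !trmx_delta addrC.
Qed.

Lemma cvg_quotient_affine (R : realType) (F : R -> R) (p q r : R) :
  (forall t, F t = r + t * p + t ^+ 2 * q) ->
  t^-1 * (F t - r) @[t --> 0^'] --> p.
Proof.
move=> FE; apply: (@cvg_trans _ ((fun t => p + t * q) @ (0 : R)^')).
  apply: near_eq_cvg; rewrite near_withinE; near=> t => t0.
  by rewrite FE; field.
apply: cvg_within_filter.
have : p + t * q @[t --> (0 : R)] --> p + 0 * q.
  by apply: cvgD; [exact: cvg_cst|apply: cvgM; [exact: cvg_id|exact: cvg_cst]].
by rewrite mul0r addr0.
Unshelve. all: by end_near. Qed.

Section LinearAndQuadraticProbes.
Context {R : realType} {d : nat}.
Implicit Types (S M U : 'M[R]_d).

Lemma nabla_lin_probe U S i j : symmetric_mx U -> nabla i j (lin_probe U) S = U i j.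
Proof.
move=> Usym; rewrite (@nabla_cvg _ _ _ _ _ _ _ (scalar_trace U 1)).
  by rewrite !trace_mul_delta (symmetric_entry j i Usym); field.
apply: (@cvg_quotient_affine _ _ _ 0) => t.
by rewrite /lin_probe mulmxDr -scalemxAr linearD linearZ /=; ring.
Qed.

Lemma nabla_cst (c : R) S i j : nabla i j (fun=> c) S = 0.
Proof.
rewrite (@nabla_cvg _ _ _ (fun=> 0)); first by rewrite addr0 mulr0.
  by move=> a u v; rewrite mulr0 addr0.
by apply: (@cvg_quotient_affine _ _ _ 0) => t; ring.
Qed.

Lemma wishart_stein_lin_probe M (a : R) U S : symmetric_mx U ->
  wishart_stein M a (lin_probe U) S = 2 * \tr ((M - S) *m U).
Proof.
move=> Usym; rewrite /wishart_stein big1 ?mulr0 ?addr0 => [|i _].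
  congr (_ * \tr (_ *m _)); apply/matrixP => i j.
  by rewrite mxE nabla_lin_probe.
apply: big1 => j _; apply: big1 => k _; apply: big1 => l _.
rewrite (_ : nabla l i _ = fun=> U l i); first by rewrite nabla_cst mulr0.
by apply/funext => X; rewrite nabla_lin_probe.
Qed.

Lemma nabla_quad_probe S i j : nabla i j quad_probe S = S i j + S j i.
Proof.
rewrite (@nabla_cvg _ _ _ _ _ _ _ (scalar_trace S 2)).
  by rewrite !trace_mul_delta; field.
set E := sym_dir i j.
apply: (@cvg_quotient_affine _ _ _ (\tr (E *m E))) => t.
rewrite /quad_probe mulmxDr !mulmxDl -!scalemxAr -!scalemxAl !linearD !linearZ /=.
by rewrite [\tr (E *m S)]mxtrace_mulC; ring.
Qed.

Lemma nabla_nabla_quad_probe S i j k l :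
  nabla j k (nabla l i quad_probe) S =
  (delta_mx i j : 'M[R]_d) k l + (i == j)%:R * (k == l)%:R.
Proof.
rewrite (_ : nabla l i _ = fun X => X l i + X i l); last first.
  by apply/funext => X; rewrite nabla_quad_probe.
rewrite (@nabla_cvg _ _ _ (fun E => E l i + E i l)).
- rewrite !mxE ![i == _]eq_sym ![l == _]eq_sym.
  by case: (j == i); case: (j == l); case: (k == i); case: (k == l) => /=; field.
- by move=> a u v; rewrite !mxE; ring.
- by apply: (@cvg_quotient_affine _ _ _ 0) => t; rewrite !mxE; ring.
Qed.

Lemma sum_mul_delta M i j :
  \sum_k \sum_l M k l * (delta_mx i j : 'M[R]_d) k l = M i j.
Proof.
transitivity (\tr (M *m delta_mx j i)); last exact: trace_mul_delta.
apply: eq_bigr => k _; rewrite mxE; apply: eq_bigr => l _.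
by rewrite !mxE andbC.
Qed.

(** The second derivative of tr(S^2) has two terms because S_ij and S_ji are the
    same coordinate: contracted with S and M, one pairs S with M and the other
    separates into the product of the traces. *)
Lemma wishart_stein_quad_probe M (a : R) S : symmetric_mx S ->
  wishart_stein M a quad_probe S =
  4 * (\tr (M *m S) - \tr (S *m S)) + 4 / a * (\tr (M *m S) + \tr S * \tr M).
Proof.
move=> Ssym; have Sji i j : S j i = S i j by exact: symmetric_entry.
rewrite /wishart_stein; congr (_ + _ * _).
  rewrite (_ : \matrix_(_, _) _ = 2 *: S); last first.
    by apply/matrixP => i j; rewrite !mxE nabla_quad_probe Sji; ring.
  by rewrite -scalemxAr linearZ /= mulmxBl linearB /=; ring.
transitivity (\sum_i \sum_j (S i j * M i j + S i j * (i == j)%:R * \tr M)).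
  apply: eq_bigr => i _; apply: eq_bigr => j _.
  rewrite -[in RHS](sum_mul_delta M i j).
  have -> : \tr M = \sum_k \sum_l M k l * (k == l)%:R.
    apply: eq_bigr => k _; rewrite (bigD1 k) //= big1 ?addr0 ?eqxx ?mulr1 //.
    by move=> l lk; rewrite eq_sym (negbTE lk) mulr0.
  rewrite !big_distrr -big_split; apply: eq_bigr => k _ /=.
  rewrite !big_distrr -big_split; apply: eq_bigr => l _ /=.
  by rewrite nabla_nabla_quad_probe; ring.
move: (\tr M) => trM; rewrite /mxtrace big_distrl -big_split.
apply: eq_bigr => i _; rewrite /= big_split /= mxE; congr (_ + _).
  by apply: eq_bigr => j _; rewrite Sji mulrC.
rewrite (bigD1 i) //= big1 ?addr0 ?eqxx ?mulr1 //.
by move=> j ji; rewrite eq_sym (negbTE ji) mulr0 mul0r.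
Qed.

End LinearAndQuadraticProbes.

(** * The Stein operator on the logarithmic probe *)

Lemma quadratic_form_eig (R : realType) d (S H : 'M[R]_d) lam (x : 'rV[R]_d) :
  is_eigdec S (H, lam) ->
  (x *m S *m x^T) 0 0 = \sum_a lam 0 a * (x *m H) 0 a ^+ 2.
Proof.
move=> [/= _ ->]; have -> : x *m (H *m diag_mx lam *m H^T) *m x^T =
    (x *m H) *m diag_mx lam *m (x *m H)^T by rewrite trmx_mul !mulmxA.
rewrite mul_mx_diag mxE; apply: eq_bigr => a _.
by rewrite [(\matrix_(_, _) _) _ _]mxE [(x *m H)^T _ _]mxE; ring.
Qed.

Lemma posdef_eig_gt0 (R : realType) d (S H : 'M[R]_d) lam a :
  posdef S -> is_eigdec S (H, lam) -> 0 < lam 0 a.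
Proof.
move=> [_ pd] SH; have HtH : H^T *m H = 1%:M by case: SH => /= /mulmx1C.
have aH : row a H^T *m H = delta_mx 0 a by rewrite -row_mul HtH row1.
have := pd (row a H^T); rewrite (quadratic_form_eig _ SH) aH (bigD1 a) //=.
rewrite mxE !eqxx expr1n mulr1 big1 ?addr0 => [|b ba]; last first.
  by rewrite mxE (negbTE ba) andbF expr0n mulr0.
apply; apply/eqP => r0; have /rowP/(_ a) := aH.
by rewrite r0 mul0mx !mxE !eqxx => /eqP; rewrite eq_sym oner_eq0.
Qed.

Lemma eig_lower_bound (R : realType) d (lam : 'rV[R]_d) :
  (forall a, 0 < lam 0 a) -> exists2 c, 0 < c & forall a, c <= lam 0 a.
Proof.
move=> lam0; have H1 : \forall c \near (0 : R)^'+, forall a, c <= lam 0 a.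
  by apply: filter_forall => a; exact: nbhs_right_le.
have H0 : \forall c \near (0 : R)^'+, 0 < c by exact: nbhs_right_gt.
by have [c [? ?]] := filter_ex (filterI H0 H1); exists c.
Qed.

(** Uniform positivity: it makes the positive definite cone a countable union of
    closed sets. *)
Lemma posdef_coercive (R : realType) d (S : 'M[R]_d) : posdef S ->
  exists2 c, 0 < c & forall x : 'rV[R]_d,
    c * (x *m x^T) 0 0 <= (x *m S *m x^T) 0 0.
Proof.
move=> Spd; have [Ssym _] := Spd; have [[H lam] SH] := symmetric_is_eigdec Ssym.
have [c c0 cle] := eig_lower_bound (fun a => posdef_eig_gt0 a Spd SH).
exists c => // x; have HH : H *m H^T = 1%:M by case: SH.
have -> : x *m x^T = (x *m H) *m (x *m H)^T.
  by rewrite trmx_mul mulmxA -(mulmxA x) HH mulmx1.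
rewrite (quadratic_form_eig _ SH) mxE big_distrr; apply: ler_sum => a _ /=.
by rewrite [(x *m H)^T _ _]mxE -expr2 ler_wpM2r ?sqr_ge0.
Qed.

Section LogProbe.
Context {R : realType} {d : nat}.
Implicit Types (S M H : 'M[R]_d) (lam : 'rV[R]_d).

Let xlnx (x : R) := x * ln x - x.

Lemma is_derive_xlnx (x : R) : 0 < x -> is_derive x 1 xlnx (ln x).
Proof.
move=> x0; have lnx := is_derive1_ln x0.
apply: is_derive_eq; rewrite /GRing.scale /= divff ?gt_eqF //; ring.
Qed.

Lemma log_probe_specfun S : symmetric_mx S -> log_probe S = \tr (specfun xlnx S).
Proof.
move=> /symmetric_is_eigdec[[H lam] SH].
rewrite /log_probe (logmxE SH) (specfunE _ SH); have [/= /mulmx1C HtH SE] := SH.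
congr (\tr _); rewrite {1 2}SE !mulmxA -(mulmxA (H *m _)) HtH mulmx1.
rewrite -mulmxBl -mulmxA -mulmxBr; congr (_ *m _ *m _).
rewrite mul_diag_mx; apply/matrixP => i j; rewrite !mxE /xlnx.
by case: eqP => _; rewrite ?mulr1n ?mulr0n // mulr0 subrr.
Qed.

(** The scalar function x ln x - x has derivative ln, so by
    [trace_specfun_derive] the gradient of the probe is log S. *)
Lemma nabla_log_probe S H lam i j :
  is_eigdec S (H, lam) -> (forall a, 0 < lam 0 a) ->
  nabla i j log_probe S = logmx S i j.
Proof.
move=> SH lam0; have Ssym := is_eigdec_sym SH.
rewrite (@nabla_cvg _ _ _ _ _ _ _ (scalar_trace (logmx S) 1)).
  have logji : logmx S j i = logmx S i j.
    apply: symmetric_entry; rewrite /symmetric_mx (logmxE SH).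
    by rewrite !trmx_mul trmxK tr_diag_mx mulmxA.
  by rewrite !trace_mul_delta logji; field.
have Esym := @sym_dir_sym R d i j; rewrite mul1r.
have -> : (fun t : R => t^-1 * (log_probe (t *: sym_dir i j + S) - log_probe S)) =
    (fun t => t^-1 * (\tr (specfun xlnx (t *: sym_dir i j + S)) -
                      \tr (specfun xlnx S))).
  by apply/funext => t; rewrite !log_probe_specfun //; exact: symmetric_line.
by apply: (trace_specfun_derive SH Esym) => a; exact: is_derive_xlnx.
Qed.

Let log_derivative H lam (E : 'M[R]_d) i j :=
  daleckii_krein (E := E) (H := H) (l := lam) (@ln R) (fun x => x^-1) i j.

Lemma scalar_log_derivative H lam i j :
  scalar (fun E => log_derivative H lam E i j).
Proof.
move=> c u v; rewrite /log_derivative /daleckii_krein big_distrr -big_split.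
apply: eq_bigr => a _; rewrite /= big_distrr -big_split; apply: eq_bigr => b _ /=.
by rewrite mulmxDr mulmxDl -scalemxAr -scalemxAl mxE [X in H i a * (X + _)]mxE; ring.
Qed.

(** Near S the gradient of the probe is the matrix logarithm, as the
    eigenvalues remain positive; its derivative is the Daleckii-Krein formula
    for ln, whose divided difference is [log_dd]. *)
Lemma nabla_nabla_log_probe S H lam i j k l :
  is_eigdec S (H, lam) -> (forall a, 0 < lam 0 a) ->
  nabla j k (nabla l i log_probe) S =
  2^-1 * \sum_a \sum_b (H j a * H k b + H k a * H j b) *
          H l a * H i b * log_dd (lam 0 a) (lam 0 b).
Proof.
move=> SH lam0; have Ssym := is_eigdec_sym SH.
have Esym := @sym_dir_sym R d j k.
rewrite (nabla_cvg (scalar_log_derivative H lam l i)); last first.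
  have [c c0 cle] := eig_lower_bound lam0.
  have [eta eta0 near_eig] := eigenvalue_near (E := sym_dir j k) SH c0.
  apply: (@cvg_trans _ ((fun t : R => t^-1 *
      (specfun (@ln R) (t *: sym_dir j k + S) l i - specfun (@ln R) S l i)) @ 0^')).
    apply: near_eq_cvg; rewrite near_withinE.
    apply/nbhs_ballP; exists eta => //= t; rewrite /ball /= sub0r normrN => te _.
    rewrite (nabla_log_probe _ _ SH lam0).
    have [[K m] SK] : exists p, is_eigdec (t *: sym_dir j k + S) p.
      by apply/symmetric_is_eigdec/symmetric_line.
    rewrite (nabla_log_probe _ _ SK) // => b.
    have [a] := near_eig t te K m SK b.
    by rewrite ltr_norml => /andP[]; have := cle a; lra.
  by apply: (specfun_derive SH Esym) => a; exact: is_derive1_ln.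
have deltaE p q a b : (H^T *m (delta_mx p q : 'M[R]_d) *m H) a b = H p a * H q b.
  rewrite -(mul_delta_mx (0 : 'I_1)) mulmxA -mulmxA -colE -rowE.
  by rewrite mxE big_ord1 !mxE.
congr (_ * _); rewrite /log_derivative /daleckii_krein -big_split.
apply: eq_bigr => a _; rewrite -big_split; apply: eq_bigr => b _ /=.
rewrite !deltaE.
have -> : div_diff (@ln R) (fun x => x^-1) (lam 0 a) (lam 0 b) =
  log_dd (lam 0 a) (lam 0 b) by [].
by ring.
Qed.

Lemma exchange_sum4 (I : finType) (T : 'I_d -> 'I_d -> 'I_d -> 'I_d -> I -> R) :
  \sum_i \sum_j \sum_k \sum_l \sum_p T i j k l p =
  \sum_p \sum_i \sum_j \sum_k \sum_l T i j k l p.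
Proof.
rewrite [RHS]exchange_big; apply: eq_bigr => i _.
rewrite [RHS]exchange_big; apply: eq_bigr => j _.
rewrite [RHS]exchange_big; apply: eq_bigr => k _.
by rewrite [RHS]exchange_big.
Qed.

(** The contraction against S produces the entries of H^T S H, which is
    diagonal, and the one against M the entries of H^T M H. *)
Lemma bilinear_entry H S a b :
  \sum_i \sum_j S i j * H i a * H j b = (H^T *m S *m H) a b.
Proof.
rewrite [RHS]mxE exchange_big; apply: eq_bigr => j _ /=.
by rewrite mxE big_distrl; apply: eq_bigr => i _ /=; rewrite [H^T a i]mxE; ring.
Qed.

(** In an eigenbasis of S, one half of the symmetrized direction contributes
    only the terms a = b, where the eigenvalue cancels against
    [log_dd] l_a l_a = 1 / l_a and leaves tr(M) / 2; the other half contributes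
    the double sum of [calJ_of]. *)
Lemma second_order_log_probe S H lam M :
  is_eigdec S (H, lam) -> (forall a, 0 < lam 0 a) ->
  \sum_i \sum_j \sum_k \sum_l
    S i j * M k l * nabla j k (nabla l i log_probe) S = calJ S M.
Proof.
move=> SH lam0; rewrite (calJE _ SH) /calJ_of; set MS := H^T *m M *m H.
have [/= HH SE] := SH; have HtH := mulmx1C HH.
have SS : H^T *m S *m H = diag_mx lam.
  by rewrite SE !mulmxA HtH mul1mx -mulmxA HtH mulmx1.
pose c a b := 2^-1 * log_dd (lam 0 a) (lam 0 b).
transitivity (\sum_a \sum_b c a b *
    ((H^T *m S *m H) b a * MS b a + (H^T *m S *m H) b b * MS a a)).
  rewrite [RHS]pair_bigA.
  pose T i j k l (p : 'I_d * 'I_d) := S i j * M k l * (c p.1 p.2 *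
    ((H j p.1 * H k p.2 + H k p.1 * H j p.2) * H l p.1 * H i p.2)).
  transitivity (\sum_i \sum_j \sum_k \sum_l \sum_p T i j k l p).
    apply: eq_bigr => i _; apply: eq_bigr => j _.
    apply: eq_bigr => k _; apply: eq_bigr => l _.
    rewrite (nabla_nabla_log_probe _ _ _ _ SH lam0) pair_bigA -big_distrr /=.
    congr (_ * _); rewrite big_distrr; apply: eq_bigr => p _.
    by rewrite /c /=; ring.
  rewrite exchange_sum4; apply: eq_bigr => -[a b] _ /=.
  rewrite -!bilinear_entry !big_distrl -big_split big_distrr.
  apply: eq_bigr => i _ /=; rewrite !big_distrl -big_split big_distrr.
  apply: eq_bigr => j _ /=; rewrite !big_distrr -big_split big_distrr.
  apply: eq_bigr => k _ /=; rewrite !big_distrr -big_split big_distrr.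
  by apply: eq_bigr => l _ /=; rewrite /T /=; ring.
have -> : \tr M = \tr MS by rewrite /MS mxtrace_mulC mulmxA HH mul1mx.
rewrite SS exchange_big /= big_distrr /mxtrace big_distrr -big_split.
apply: eq_bigr => b _ /=.
under eq_bigr do rewrite mulrDr.
rewrite big_split /=; congr (_ + _).
  rewrite (bigD1 b) //= big1 ?addr0 => [|a ab].
    rewrite mxE eqxx mulr1n /c /log_dd eqxx; field.
    by rewrite gt_eqF.
  by rewrite mxE eq_sym (negbTE ab) mulr0n mul0r mulr0.
rewrite big_distrr; apply: eq_bigr => a _ /=.
by rewrite mxE eqxx mulr1n /c; ring.
Qed.

End LogProbe.

Lemma wishart_stein_log_probe (R : realType) d (M S : 'M[R]_d) (a : R) : posdef S ->
  wishart_stein M a log_probe S =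
  2 * (\tr (M *m logmx S) - \tr (S *m logmx S)) + 4 / a * calJ S M.
Proof.
move=> Spd; have [Ssym _] := Spd; have [[H lam] SH] := symmetric_is_eigdec Ssym.
have lam0 b := posdef_eig_gt0 b Spd SH.
rewrite /wishart_stein (second_order_log_probe _ SH lam0) -linearB -mulmxBl.
congr (_ * \tr (_ *m _) + _); apply/matrixP => i j.
by rewrite mxE (nabla_log_probe _ _ SH lam0).
Qed.

(** * The empirical Stein equations *)

Lemma sumr_ord_gt0 (R : numDomainType) m (F : 'I_m -> R) : (0 < m)%N ->
  (forall i, 0 < F i) -> 0 < \sum_i F i.
Proof.
move=> m0 F0; rewrite (bigD1 (Ordinal m0)) //= ltr_wpDr ?F0 ?sumr_ge0 //.
by move=> i _; exact: ltW.
Qed.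

Lemma log_dd_gt0 (R : realType) (x y : R) : 0 < x -> 0 < y -> 0 < log_dd x y.
Proof.
move=> x0 y0; rewrite /log_dd; have [_|xy] := eqVneq x y; first by rewrite invr_gt0.
have [xy'|yx] := ltP x y; last first.
  by rewrite divr_gt0 ?subr_gt0 ?ltr_ln // lt_neqAle eq_sym xy.
by rewrite -mulrNN -invrN !opprB divr_gt0 ?subr_gt0 ?ltr_ln.
Qed.

Lemma posdef_conj_diag_gt0 (R : realType) d (M H : 'M[R]_d) j :
  posdef M -> H^T *m H = 1%:M -> 0 < (H^T *m M *m H) j j.
Proof.
move=> [_ Mpd] HtH; have := Mpd (row j H^T).
have <- : (H^T *m M *m H) j j = (row j H^T *m M *m (row j H^T)^T) 0 0.
  by rewrite -row_mul !mxE; apply: eq_bigr => k _; rewrite !mxE.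
apply; apply/eqP => r0; have : row j (H^T *m H) = 0 by rewrite row_mul r0 mul0mx.
by rewrite HtH => /rowP/(_ j)/eqP; rewrite !mxE eqxx oner_eq0.
Qed.

Lemma posdef_trace_gt0 (R : realType) d (M : 'M[R]_d) : (0 < d)%N ->
  posdef M -> 0 < \tr M.
Proof.
move=> d0 Mpd; apply: sumr_ord_gt0 => // i.
have := @posdef_conj_diag_gt0 _ _ M 1%:M i Mpd.
by rewrite trmx1 !mulmx1 mul1mx; apply.
Qed.

Lemma calJ_gt0 (R : realType) d (S M : 'M[R]_d) : (0 < d)%N ->
  posdef S -> posdef M -> 0 < calJ S M.
Proof.
move=> d0 Spd Mpd; have [Ssym _] := Spd.
have [[H lam] SH] := symmetric_is_eigdec Ssym.
have HtH : H^T *m H = 1%:M by case: SH => /= /mulmx1C.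
have lam0 b := posdef_eig_gt0 b Spd SH.
rewrite (calJE _ SH) /calJ_of; apply: ltr_wpDr; last first.
  by rewrite mulr_gt0 ?invr_gt0 // posdef_trace_gt0.
rewrite mulr_ge0 ?invr_ge0 // sumr_ge0 // => i _; rewrite sumr_ge0 // => j _.
by rewrite ltW // !mulr_gt0 ?log_dd_gt0 ?posdef_conj_diag_gt0.
Qed.

Section SampleMean.
Context {R : realType} {d n : nat}.

Lemma sample_meanE (x : 'I_n -> R) : sample_mean x = n%:R^-1 * \sum_k x k.
Proof. by []. Qed.

Lemma trace_mul_sample_mean (A : 'M[R]_d) (B : 'I_n -> 'M[R]_d) :
  \tr (A *m sample_mean B) = sample_mean (fun k => \tr (A *m B k)).
Proof.
by rewrite sample_meanE /sample_mean -scalemxAr linearZ mulmx_sumr linear_sum.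
Qed.

Lemma symmetric_sample_mean (S : 'I_n -> 'M[R]_d) :
  (forall k, symmetric_mx (S k)) -> symmetric_mx (sample_mean S).
Proof.
move=> Ssym; rewrite /symmetric_mx /sample_mean linearZ linear_sum /=.
by congr (_ *: _); apply: eq_bigr => k _; exact: Ssym.
Qed.

Lemma posdef_sample_mean (S : 'I_n -> 'M[R]_d) : (0 < n)%N ->
  (forall k, posdef (S k)) -> posdef (sample_mean S).
Proof.
move=> n0 Spd; split.
  by apply: symmetric_sample_mean => k; case: (Spd k).
move=> x x0; rewrite /sample_mean -scalemxAr -scalemxAl mxE.
rewrite mulr_gt0 ?invr_gt0 ?ltr0n //.
rewrite mulmx_sumr mulmx_suml summxE; apply: sumr_ord_gt0 => // k.
by case: (Spd k) => _ /(_ x x0).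
Qed.

(** The mean of the Stein operator on f_U is 2 tr(U (M - Mhat)). Take
    U = M - Mhat, for which it is twice a sum of squares. *)
Lemma stein_moment_linear_probes (S : 'I_n -> 'M[R]_d) M a : (0 < n)%N ->
  (forall k, symmetric_mx (S k)) -> symmetric_mx M ->
  (forall U, symmetric_mx U ->
     sample_mean (fun k => wishart_stein M a (lin_probe U) (S k)) = 0) <->
  M = sample_mean S.
Proof.
move=> n0 Ssym Msym.
have meanE U : symmetric_mx U ->
    sample_mean (fun k => wishart_stein M a (lin_probe U) (S k)) =
    2 * \tr (U *m (M - sample_mean S)).
  move=> Usym; rewrite mulmxBr linearB /= trace_mul_sample_mean !sample_meanE.
  under eq_bigr do rewrite wishart_stein_lin_probe // mulmxBl linearB /=
    mxtrace_mulC [\tr (S _ *m _)]mxtrace_mulC.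
  rewrite -big_distrr /= sumrB sumr_const card_ord -[X in X - _]mulr_natl.
  have : n%:R != 0 :> R by rewrite pnatr_eq0 -lt0n.
  by move=> nz; field.
have Dsym : symmetric_mx (M - sample_mean S).
  by rewrite /symmetric_mx linearB /= Msym symmetric_sample_mean.
split=> [eqs|ME U Usym]; last first.
  by rewrite meanE // -ME subrr mulmx0 linear0 mulr0.
apply/eqP; rewrite -subr_eq0; set D := M - _ in Dsym meanE *.
have /eqP := eqs D Dsym; rewrite meanE // mulf_eq0 pnatr_eq0 /=.
have DDE : \tr (D *m D) = \sum_i \sum_j D i j ^+ 2.
  apply: eq_bigr => i _; rewrite mxE; apply: eq_bigr => j _.
  by rewrite (symmetric_entry j i Dsym) expr2.
have D2 i : 0 <= \sum_j D i j ^+ 2 by apply: sumr_ge0 => j _; exact: sqr_ge0.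
rewrite DDE psumr_eq0 // => /allP D0; apply/eqP/matrixP => i j; rewrite [RHS]mxE.
have := D0 i (mem_index_enum _); rewrite /= psumr_eq0 => [|k _]; last exact: sqr_ge0.
by move=> /allP/(_ j (mem_index_enum _)) /=; rewrite sqrf_eq0 => /eqP.
Qed.

(** Shared by the quadratic and the logarithmic estimators. A nonzero numerator
    is what makes num / den an admissible shape parameter. *)
Lemma is_stein_momP (q : 'M[R]_d -> R) (S : 'I_n -> 'M[R]_d) (c num den : R) :
  (0 < n)%N -> (forall k, symmetric_mx (S k)) ->
  c != 0 -> num != 0 -> den != 0 ->
  (forall a, sample_mean (fun k => wishart_stein (sample_mean S) a q (S k)) =
     c * (num / a - den)) ->
  forall M a V, is_stein_mom (lin_probes_and q) S M a V <->
    [/\ M = sample_mean S, a = num / den & V = (num / den)^-1 *: sample_mean S].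
Proof.
move=> n0 Ssym c0 num0 den0 meanq M a V; split.
  move=> [Msym a0 eqs ->].
  have ME : M = sample_mean S.
    apply/(stein_moment_linear_probes a n0 Ssym Msym) => U Usym; apply: eqs.
    by left; exists U.
  have : c * (num / a - den) = 0 by rewrite -meanq -ME; apply: eqs; right.
  move/eqP; rewrite mulf_eq0 (negbTE c0) subr_eq0 => /eqP aE.
  have -> : a = num / den by rewrite -aE; field; rewrite num0 a0.
  by rewrite ME.
move=> [ME aE VE].
have Msym : symmetric_mx M by rewrite ME; exact: symmetric_sample_mean.
have a0 : a != 0 by rewrite aE mulf_neq0 ?invr_eq0.
split => //; last by rewrite VE aE ME.
move=> f [[U Usym ->]|->].
  by have := (stein_moment_linear_probes a n0 Ssym Msym).2 ME U Usym.
by rewrite ME meanq aE; field; rewrite num0 den0.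
Qed.

Lemma stein_moment_estimators (S : 'I_n -> 'M[R]_d) :
  (0 < d)%N -> (0 < n)%N -> (forall k, posdef (S k)) ->
    let Mhat := sample_mean S in
    let den_quad := sample_mean (fun k => \tr (S k *m S k)) -
                    \tr (Mhat *m Mhat) in
    let alpha_quad := ((\tr Mhat) ^+ 2 + \tr (Mhat *m Mhat)) / den_quad in
    let den_log := sample_mean (fun k => \tr (S k *m logmx (S k))) -
                   \tr (Mhat *m sample_mean (fun k => logmx (S k))) in
    let alpha_log := 2 * sample_mean (fun k => calJ (S k) Mhat) / den_log in
    (den_quad != 0 ->
      forall (M : 'M[R]_d) (a : R) (V : 'M[R]_d),
        is_stein_mom (lin_probes_and quad_probe) S M a V <->
        [/\ M = Mhat, a = alpha_quad & V = alpha_quad^-1 *: Mhat]) /\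
    (den_log != 0 ->
      forall (M : 'M[R]_d) (a : R) (V : 'M[R]_d),
        is_stein_mom (lin_probes_and log_probe) S M a V <->
        [/\ M = Mhat, a = alpha_log & V = alpha_log^-1 *: Mhat]).
Proof.
move=> d0 n0 Spd Mhat den_quad alpha_quad den_log alpha_log.
have Ssym k : symmetric_mx (S k) by case: (Spd k).
have Mpd : posdef Mhat by exact: posdef_sample_mean.
have Msym : symmetric_mx Mhat by case: Mpd.
have nz : n%:R != 0 :> R by rewrite pnatr_eq0 -lt0n.
split=> den0.
  apply: (is_stein_momP (c := 4)) => //.
  - rewrite gt_eqF // ltr_wpDr ?exprn_gt0 ?posdef_trace_gt0 //.
    rewrite sumr_ge0 // => i _; rewrite mxE sumr_ge0 // => j _.
    by rewrite (symmetric_entry j i Msym) -expr2 sqr_ge0.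
  - move=> a; rewrite -/Mhat /den_quad !sample_meanE.
    under eq_bigr do rewrite wishart_stein_quad_probe //.
    rewrite big_split /= -!big_distrr /= !big_split /= sumrN -big_distrl /=.
    have trM : \tr Mhat = n%:R^-1 * \sum_k \tr (S k).
      by rewrite -[Mhat]mul1mx trace_mul_sample_mean; under eq_fun do rewrite mul1mx.
    have := trace_mul_sample_mean Mhat S; rewrite -/Mhat sample_meanE => trMM.
    by rewrite trMM trM; ring.
apply: (is_stein_momP (c := 2)) => //.
- rewrite mulf_neq0 ?pnatr_eq0 // sample_meanE mulf_neq0 ?invr_eq0 //.
  by rewrite gt_eqF //; apply: sumr_ord_gt0 => // k; rewrite calJ_gt0.
- move=> a; rewrite -/Mhat /den_log trace_mul_sample_mean !sample_meanE.
  under eq_bigr do rewrite wishart_stein_log_probe //.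
  rewrite big_split /= -!big_distrr /= big_split /= sumrN; ring.
Qed.

End SampleMean.

(** * Wishart matrices are almost surely positive definite *)

Section Measurability.
Context {R : realType} {d : nat}.

Lemma closed_measurable_mx (B : set 'M[R]_d) :
  closed B -> measurable (B : set (borel_mx R d)).
Proof.
move=> Bc; rewrite -[B]setCK; apply: measurableC; apply: sub_gen_smallest.
exact: closed_openC.
Qed.

Lemma quadratic_form_continuous (x : 'rV[R]_d) :
  continuous (fun S : 'M[R]_d => (x *m S *m x^T) 0 0).
Proof.
have E (T : 'M[R]_d) : (x *m T *m x^T) 0 0 = \sum_j \sum_i x 0 i * T i j * x 0 j.
  rewrite mxE; apply: eq_bigr => j _; rewrite mxE big_distrl.
  by apply: eq_bigr => i _; rewrite [x^T _ _]mxE.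
rewrite (funext E); apply: continuous_big => [|j _]; first exact: add_continuous.
apply: continuous_big => [|i _ S]; first exact: add_continuous.
have ij := @coord_continuous R d d i j S.
exact: (cvgM (cvgM (cvg_cst (x 0 i)) ij) (cvg_cst (x 0 j))).
Qed.

(** Exhibits the positive definite cone as a Borel set, since coercivity with a
    given constant is a closed condition. *)
Lemma posdef_countable_union : [set S : 'M[R]_d | posdef S] =
  \bigcup_m ([set S | symmetric_mx S] `&`
     \bigcap_(x in [set: 'rV[R]_d])
       [set S | m.+1%:R^-1 * (x *m x^T) 0 0 <= (x *m S *m x^T) 0 0]).
Proof.
apply/seteqP; split=> [S /= Spd|S [m _ [Ssym SP]]].
  have [c c0 cP] := posdef_coercive Spd; have [Ssym _] := Spd.
  have [m mc] : exists m : nat, m.+1%:R^-1 <= c.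
    exists (Num.trunc c^-1); rewrite -[leRHS]invrK.
    rewrite lef_pV2 ?posrE ?invr_gt0 ?ltr0n //; by rewrite ltW // truncnS_gt.
  exists m => //; split=> // x _ /=.
  by apply: le_trans (cP x); rewrite ler_wpM2r // sqnorm_ge0.
split=> // x x0; have := SP x I => /=; apply: lt_le_trans.
by rewrite mulr_gt0 ?invr_gt0 ?ltr0n // sqnorm_gt0.
Qed.

Lemma measurable_posdef :
  measurable ([set S | posdef S] : set (borel_mx R d)).
Proof.
rewrite posdef_countable_union; apply: bigcupT_measurable => m.
apply: closed_measurable_mx; apply: closedI.
  rewrite (_ : [set S | _] = \bigcap_(p in [set: 'I_d * 'I_d])
      [set S : 'M[R]_d | S p.1 p.2 - S p.2 p.1 = 0]); last first.
    apply/seteqP; split=> [S /= Ssym p _ /=|S SP].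
      by rewrite (symmetric_entry _ _ Ssym) subrr.
    apply/matrixP => i j; rewrite mxE; apply/eqP.
    by rewrite -subr_eq0; apply/eqP; exact: (SP (j, i)).
  apply: closed_bigI => p _.
  apply: (@preimage_closed _ _ (fun S : 'M[R]_d => S p.1 p.2 - S p.2 p.1) [set 0]).
    move=> S _; have entry i j := @coord_continuous R d d i j S.
    exact: (cvgB (entry p.1 p.2) (entry p.2 p.1)).
  exact: closed_eq.
apply: closed_bigI => x _.
apply: (@preimage_closed _ _ (fun S : 'M[R]_d => (x *m S *m x^T) 0 0)
  [set y | m.+1%:R^-1 * (x *m x^T) 0 0 <= y]).
  by move=> S _; exact: quadratic_form_continuous.
exact: closed_ge.
Qed.

Lemma coord_integral0 s (S : 'M[R]_d) : coord_integral s (cst 0%E) S = 0%E.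
Proof.
elim: s S => //= p s IHs S.
by under eq_integral do rewrite IHs; rewrite integral0.
Qed.

Lemma wishart_law_not_posdef (alpha : R) Sigma :
  wishart_law alpha Sigma (~` [set S : 'M[R]_d | posdef S]) = 0%E.
Proof.
rewrite /wishart_law /pd_integral /sym_integral -[RHS](coord_integral0
  [seq p : 'I_d * 'I_d <- enum {: 'I_d * 'I_d} | (p.1 <= p.2)%N] 0).
congr (coord_integral _ _ _); apply/funext => S.
by case: asboolP => // -[? []].
Qed.

End Measurability.

Theorem proposition4p8 (R : realType) (d n : nat) (disp : measure_display)
    (T : measurableType disp) (P : probability T R)
    (W : 'I_n -> {RV P >-> borel_mx R d}) (alpha : R) (Sigma : 'M[R]_d)
    (d_gt0 : (0 < d)%N) (n_ge2 : (2 <= n)%N)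
    (alpha_gt : d%:R - 1 < alpha) (Sigma_pd : posdef Sigma)
    (W_iid : iid_wishart W alpha Sigma) :
  {ae P, forall w : T,
    let S := fun k : 'I_n => (W k w : 'M[R]_d) in
    let Mhat := sample_mean S in
    let den_quad := sample_mean (fun k => \tr (S k *m S k)) -
                    \tr (Mhat *m Mhat) in
    let alpha_quad := ((\tr Mhat) ^+ 2 + \tr (Mhat *m Mhat)) / den_quad in
    let den_log := sample_mean (fun k => \tr (S k *m logmx (S k))) -
                   \tr (Mhat *m sample_mean (fun k => logmx (S k))) in
    let alpha_log := 2 * sample_mean (fun k => calJ (S k) Mhat) / den_log in
    (den_quad != 0 ->
      forall (M : 'M[R]_d) (a : R) (V : 'M[R]_d),
        is_stein_mom (lin_probes_and quad_probe) S M a V <->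
        [/\ M = Mhat, a = alpha_quad & V = alpha_quad^-1 *: Mhat]) /\
    (den_log != 0 ->
      forall (M : 'M[R]_d) (a : R) (V : 'M[R]_d),
        is_stein_mom (lin_probes_and log_probe) S M a V <->
        [/\ M = Mhat, a = alpha_log & V = alpha_log^-1 *: Mhat])}.
Proof.
have Wpd k : {ae P, forall w, posdef (W k w : 'M[R]_d)}.
  have mB := measurableC (@measurable_posdef R d).
  apply/negligibleP.
    exact: (measurable_funPTI (W k) mB).
  have [_ /(_ k _ mB)] := W_iid.
  by rewrite wishart_law_not_posdef.
have n0 : (0 < n)%N by exact: ltnW.
have : {ae P, forall w, forall k, posdef (W k w : 'M[R]_d)}.
  exact: filter_forall.
apply: filterS => w Swpd.
exact: (stein_moment_estimators d_gt0 n0 Swpd).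
Qed.
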